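(* Let $n_e \ge 1$ and $T \ge 1$ be integers, let $\gamma \in [0,1)$, let $A \in \mathbb{R}^{n_e \times n_e}$ be any left stochastic matrix, and let $B \in \mathbb{R}^{n_e \times n_e}$ be the matrix all of whose entries equal $\frac{1}{n_e}$. Let $Q, Q_f, R \in \mathbb{R}^{n_e \times n_e}$ be positive semidefinite, and consider the control problem $$\underset{\mathbf{u}_t,\ t=0,\dots,T-1}{\text{minimize}} \quad \sum_{t=0}^{T-1}\left(\mathbf{x}_t^\top Q \mathbf{x}_t + \mathbf{u}_t^\top R \mathbf{u}_t\right) + \mathbf{x}_T^\top Q_f \mathbf{x}_T$$ subject to $\mathbf{x}_{t+1} = \gamma A \mathbf{x}_t + (1-\gamma) B \mathbf{u}_t$ for $t = 0, \dots, T-1$, $\mathbf{x}_t \in \Delta$ for $t = 0, \dots, T$, and $\mathbf{u}_t \in \Delta$ for $t = 0, \dots, T-1$. Then the unique steady state of the system is $$\mathbf{x}^* = \frac{1-\gamma}{n_e}\,(I_{n_e} - \gamma A)^{-1}\,\mathbb{I},$$ where $I_{n_e}$ is the $n_e \times n_e$ identity matrix and $\mathbb{I} = (1,1,\dots,1)^\top \in \mathbb{R}^{n_e}$ is the all-ones vector.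
   Context: $\Delta = \{ f \in \mathbb{R}^{n_e} : \sum_{i=1}^{n_e} f_i = 1,\ f_i \ge 0 \text{ for all } i \}$ is the probability simplex in $\mathbb{R}^{n_e}$. A matrix in $\mathbb{R}^{n_e \times n_e}$ is called left stochastic if each of its columns belongs to $\Delta$. A steady state of the system is a state $\mathbf{x}^* \in \Delta$ that is a fixed point of the dynamics with admissible controls, i.e. $\mathbf{x}^* = \gamma A \mathbf{x}^* + (1-\gamma) B \mathbf{u}$ for a control $\mathbf{u} \in \Delta$. *)

(* Defs.v *)
From mathcomp Require Import all_boot all_order all_algebra.
From mathcomp Require Import reals.

Set Implicit Arguments.
Unset Strict Implicit.
Unset Printing Implicit Defensive.

Import Order.TTheory GRing.Theory Num.Theory.
Local Open Scope ring_scope.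

Definition simplex (R : realType) (n : nat) (f : 'cV[R]_n) : Prop :=
  \sum_(i < n) f i 0 = 1 /\ forall i, 0 <= f i 0.

Definition left_stochastic (R : realType) (n : nat) (A : 'M[R]_n) : Prop :=
  forall j, simplex (col j A).

Definition quad_form (R : realType) (n : nat) (M : 'M[R]_n) (x : 'cV[R]_n) : R :=
  (x^T *m M *m x) 0 0.

Definition psd (R : realType) (n : nat) (M : 'M[R]_n) : Prop :=
  M^T = M /\ forall x, 0 <= quad_form M x.

Record control_problem (R : realType) (n : nat) := ControlProblem {
  horizon : nat;
  discount : R;
  state_mx : 'M[R]_n;
  input_mx : 'M[R]_n;
  state_cost : 'M[R]_n;
  final_cost : 'M[R]_n;
  input_cost : 'M[R]_n
}.

Section ControlProblemTheory.
Variables (R : realType) (n : nat) (P : control_problem R n).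

Definition dynamics (x u : 'cV[R]_n) : 'cV[R]_n :=
  discount P *: (state_mx P *m x) + (1 - discount P) *: (input_mx P *m u).

(* Trajectories are indexed by all of nat; only the states x_0, ..., x_T and
   the controls u_0, ..., u_(T-1) matter, where T is the horizon. *)
Definition feasible (x u : nat -> 'cV[R]_n) : Prop :=
  [/\ forall t, (t < horizon P)%N -> x t.+1 = dynamics (x t) (u t),
      forall t, (t <= horizon P)%N -> simplex (x t)
    & forall t, (t < horizon P)%N -> simplex (u t)].

Definition total_cost (x u : nat -> 'cV[R]_n) : R :=
  \sum_(t < horizon P)
     (quad_form (state_cost P) (x t) + quad_form (input_cost P) (u t))
  + quad_form (final_cost P) (x (horizon P)).

(* The minimization is over the controls: the initial state x_0 is given. *)
Definition optimal (x u : nat -> 'cV[R]_n) : Prop :=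
  feasible x u /\
  forall y v, feasible y v -> y 0%N = x 0%N -> total_cost x u <= total_cost y v.

Definition steady_state (x : 'cV[R]_n) : Prop :=
  simplex x /\ exists u, simplex u /\ x = dynamics x u.

End ControlProblemTheory.

(* Main.v *)
Require Import Defs.
From mathcomp Require Import all_boot all_order all_algebra.
From mathcomp Require Import reals.
From mathcomp Require Import lra.

Import Order.TTheory GRing.Theory Num.Theory.
Local Open Scope ring_scope.

(** Since every entry of [B] is [1/n], [B u] is the same vector for all [u] in
    the simplex, so steady states solve the single linear system
    [(I - gamma A) x = (1 - gamma)/n * 1].  As [A] is left stochastic, it
    preserves the total mass of a vector, and comparing the masses of the
    negative parts of [x] and [gamma A x] shows that [(I - gamma A) x >= 0]
    forces [x >= 0].  Applied to [x] and [-x], this makes [I - gamma A]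
    injective, hence invertible; applied to the solution, it gives
    nonnegativity, and mass preservation gives total mass 1. *)

Lemma left_stochastic_ge0 (R : realType) (n : nat) (A : 'M[R]_n) i j :
  left_stochastic A -> 0 <= A i j.
Proof. by move=> /(_ j)[_ /(_ i)]; rewrite mxE. Qed.

Lemma sum_left_stochastic_mulmx (R : realType) (n : nat) (A : 'M[R]_n)
    (x : 'cV[R]_n) :
  left_stochastic A -> \sum_i (A *m x) i 0 = \sum_i x i 0.
Proof.
move=> stA; under eq_bigr do rewrite mxE.
rewrite exchange_big /=; apply: eq_bigr => j _.
rewrite -mulr_suml; have [+ _] := stA j.
by under eq_bigr do rewrite mxE; move=> ->; rewrite mul1r.
Qed.

(** Phrased through preimages rather than [invmx], so that it can be used to prove invertibility. *)
Lemma left_stochastic_resolvent_ge0 (R : realType) (n : nat) (gamma : R)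
    (A : 'M[R]_n) (x : 'cV[R]_n) :
  0 <= gamma -> gamma < 1 -> left_stochastic A ->
  (forall i, 0 <= ((1%:M - gamma *: A) *m x) i 0) -> forall i, 0 <= x i 0.
Proof.
move=> g0 g1 stA Mx0.
(* [y] is the negative part of [x]; the aim is [y = 0]. *)
pose y : 'cV[R]_n := \col_i Num.max 0 (- x i 0).
have y0 i : 0 <= y i 0 by rewrite mxE le_max lexx.
have yx i : - y i 0 <= x i 0 by rewrite lerNl mxE le_max lexx orbT.
have Ay0 i : 0 <= (A *m y) i 0.
  by rewrite mxE sumr_ge0 // => j _; rewrite mulr_ge0 ?left_stochastic_ge0.
have Ayx i : - (A *m y) i 0 <= (A *m x) i 0.
  rewrite !mxE -sumrN; apply: ler_sum => j _; rewrite -mulrN.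
  by rewrite ler_wpM2l ?left_stochastic_ge0.
(* Both arguments of the maximum are bounded: [0] by positivity, and [- x] by
   [- gamma A x <= gamma A y]. *)
have y_le i : y i 0 <= gamma * (A *m y) i 0.
  rewrite {1}mxE ge_max mulr_ge0 //= lerNl -mulrN.
  apply: le_trans (ler_wpM2l g0 (Ayx i)) _.
  by have := Mx0 i; rewrite mulmxBl mul1mx -scalemxAl !mxE subr_ge0.
have S0 : 0 <= \sum_i y i 0 by apply: sumr_ge0.
have /eqP : \sum_i y i 0 = 0.
  have : \sum_i y i 0 <= gamma * \sum_i y i 0.
    by rewrite -{2}(sum_left_stochastic_mulmx _ _ _ y stA) mulr_sumr ler_sum.
  by move=> le_S; nra.
rewrite psumr_eq0 // => /allP y_eq0 i.
by have := yx i; rewrite (eqP (y_eq0 i (mem_index_enum i))) oppr0.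
Qed.

Lemma left_stochastic_resolvent_unit (R : realType) (n : nat) (gamma : R)
    (A : 'M[R]_n) :
  0 <= gamma -> gamma < 1 -> left_stochastic A ->
  1%:M - gamma *: A \in unitmx.
Proof.
move=> g0 g1 stA; set M := 1%:M - _.
(* Row-freeness concerns row vectors, so the transpose turns it into injectivity of [M] on
   columns. *)
rewrite -unitmx_tr -row_free_unit; apply: inj_row_free => v vM0.
have Mv0 : M *m v^T = 0.
  by apply: trmx_inj; rewrite trmx_mul trmxK vM0 trmx0.
apply: trmx_inj; rewrite trmx0; apply/colP => i.
apply/eqP; rewrite [X in _ == X]mxE eq_le; apply/andP; split.
  suff : 0 <= (- v^T) i 0 by rewrite [(- v^T) i 0]mxE oppr_ge0.
  apply: (@left_stochastic_resolvent_ge0 R n gamma A) => // j.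
  by rewrite mulmxN Mv0 oppr0 mxE.
apply: (@left_stochastic_resolvent_ge0 R n gamma A) => // j.
by rewrite Mv0 mxE.
Qed.

Lemma const_mx_mul_simplex (R : realType) (n : nat) (a : R) (u : 'cV[R]_n) :
  simplex u -> const_mx a *m u = const_mx a :> 'cV[R]_n.
Proof.
move=> [u1 _]; apply/colP => i; rewrite !mxE.
by under eq_bigr do rewrite mxE; rewrite -mulr_sumr u1 mulr1.
Qed.

Theorem mainTheorem2 (R : realType) (n T : nat) (gamma : R)
    (A B Q Qf Rc : 'M[R]_n) :
  (1 <= n)%N -> (1 <= T)%N ->
  0 <= gamma -> gamma < 1 ->
  left_stochastic A ->
  B = const_mx (n%:R^-1) ->
  psd Q -> psd Qf -> psd Rc ->
  let P := ControlProblem T gamma A B Q Qf Rc in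
  let xstar : 'cV[R]_n :=
    ((1 - gamma) / n%:R) *: (invmx (1%:M - gamma *: A) *m const_mx 1) in
  [/\ 1%:M - gamma *: A \in unitmx,
      steady_state P xstar
    & forall x, steady_state P x -> x = xstar].
Proof.
move=> n1 _ g0 g1 stA -> _ _ _ P xstar.
have Munit := left_stochastic_resolvent_unit _ _ _ _ g0 g1 stA.
have n0 : n%:R != 0 :> R by rewrite pnatr_eq0 -lt0n.
(* [b] is the common input term produced by all controls in the simplex. *)
pose b : 'cV[R]_n := (1 - gamma) *: const_mx n%:R^-1.
have xstarE : xstar = invmx (1%:M - gamma *: A) *m b.
  rewrite /xstar scalemxAr; congr (_ *m _).
  by apply/colP => i; rewrite !mxE mulr1.
have Mxstar : (1%:M - gamma *: A) *m xstar = b by rewrite xstarE mulKVmx.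
have dynE x u : simplex u -> dynamics P x u = gamma *: (A *m x) + b.
  by move=> su; rewrite /dynamics /= const_mx_mul_simplex.
have xstar_fix : xstar = gamma *: (A *m xstar) + b.
  by rewrite -Mxstar mulmxBl mul1mx -scalemxAl addrC subrK.
have sxstar : simplex xstar.
  split.
    (* Summing the fixed-point equation gives [s = gamma s + (1 - gamma)] for the mass [s], hence
       [s = 1] as [gamma < 1]. *)
    have : \sum_i xstar i 0 = gamma * (\sum_i xstar i 0) + (1 - gamma).
      rewrite -{2}(sum_left_stochastic_mulmx _ _ _ xstar stA) mulr_sumr.
      have <- : \sum_i b i 0 = 1 - gamma.
        under eq_bigr do rewrite !mxE.
        by rewrite sumr_const card_ord -[LHS]mulr_natr mulfVK.
      rewrite -big_split /=; apply: eq_bigr => i _.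
      by rewrite {1}xstar_fix !mxE.
    by move=> S_fix; nra.
  apply: (left_stochastic_resolvent_ge0 _ _ _ _ _ g0 g1 stA) => i.
  by rewrite Mxstar !mxE mulr_ge0 ?invr_ge0 ?subr_ge0 ?ler0n // ltW.
split=> //.
  (* Every control in the simplex has the same effect, so [xstar] itself is an
     admissible choice. *)
  by split=> //; exists xstar; rewrite dynE.
move=> x [_ [u [su]]]; rewrite dynE // => x_fix.
rewrite xstarE; apply: (canRL (mulKmx Munit)).
by rewrite mulmxBl mul1mx -scalemxAl {1}x_fix addrAC subrr add0r.
Qed.
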